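(* Let $G$ be a $d$-degenerate graph with $n$ vertices such that $\Delta(G)<\frac{\sqrt{n}-2d-1}{2}$. Then $O\chi(G)=\lceil\sqrt{n}\,\rceil$.
   Context: A graph is $d$-degenerate if there is an ordering of its vertices in which each vertex has at most $d$ neighbours occurring earlier in the ordering. $\Delta(G)$ denotes the maximum degree. Two proper vertex colourings $c_1,c_2$ of a graph are orthogonal if whenever two distinct vertices receive the same colour in one colouring, they receive different colours in the other (equivalently, $v\mapsto (c_1(v),c_2(v))$ is injective). The orthogonal chromatic number $O\chi(G)$ is the minimum number $c$ such that $G$ has a pair of orthogonal proper vertex colourings each using at most $c$ colours. *)

(* Defs.v *)
From mathcomp Require Import all_boot all_order all_algebra.
From mathcomp Require Import reals.

Set Implicit Arguments.
Unset Strict Implicit.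
Unset Printing Implicit Defensive.

Record sgraph := SGraph {
  vertex :> finType;
  adj : rel vertex;
  adj_sym : symmetric adj;
  adj_irrefl : irreflexive adj
}.

Arguments adj {s} : rename.

Definition degree (G : sgraph) (v : G) : nat := #|[set u : G | adj v u]|.

(* Equals 0 on the graph with no vertices. *)
Definition max_degree (G : sgraph) : nat := \max_(v : G) degree v.

(* [s] lists every vertex exactly once. *)
Definition degenerate (d : nat) (G : sgraph) : Prop :=
  exists s : seq G,
    [/\ uniq s, forall v : G, v \in s
      & forall v : G, #|[set u : G | adj v u & index u s < index v s]| <= d].

Definition proper_colouring (G : sgraph) (c : nat) (f : {ffun G -> 'I_c}) :
    bool :=
  [forall u : G, forall v : G, adj u v ==> (f u != f v)].

Definition orthogonal_colourings (G : sgraph) (c : nat)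
    (f g : {ffun G -> 'I_c}) : bool :=
  [forall u : G, forall v : G, (u != v) ==>
     (((f u == f v) ==> (g u != g v)) && ((g u == g v) ==> (f u != f v)))].

(* Colours are taken in ['I_c], not all of which need to be used. *)
Definition orthogonally_colourable (G : sgraph) (c : nat) : bool :=
  [exists f : {ffun G -> 'I_c}, exists g : {ffun G -> 'I_c},
     [&& proper_colouring f, proper_colouring g & orthogonal_colourings f g]].

Lemma orthogonally_colourable_ex (G : sgraph) :
  exists c, orthogonally_colourable G c.
Proof.
exists #|G|; pose f := [ffun v : G => enum_rank v].
have fE (u v : G) : (f u == f v) = (u == v).
  by rewrite !ffunE (inj_eq enum_rank_inj).
have pf : proper_colouring f.
  apply/forallP => u; apply/forallP => v; apply/implyP => uv.
  by rewrite fE; apply: contraTneq uv => ->; rewrite adj_irrefl.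
apply/existsP; exists f; apply/existsP; exists f; rewrite pf /=.
apply/forallP => u; apply/forallP => v; apply/implyP => uv.
by rewrite fE (negPf uv).
Qed.

Definition orthogonal_chromatic_number (G : sgraph) : nat :=
  ex_minn (orthogonally_colourable_ex G).

(* Main.v *)
(** Identify a pair of orthogonal colourings with [c] colours with an injective
    placement of the vertices in the [c x c] grid such that adjacent vertices
    share neither a row nor a column. Start from any injective placement and
    treat the vertices in a degenerate order, keeping the placement good on the
    vertices already treated. The next vertex [v] is exchanged with the content
    [w] of some cell [q] (possibly empty): this is harmless as soon as the cross
    of [q] contains none of the at most [d] earlier neighbours of [v], and [w]
    is adjacent to no vertex in the cross of the old cell of [v]. As a cross has
    at most [2c] cells, these conditions exclude at most [2c(d + Delta)] cells
    out of [c ^ 2], so [2(d + Delta) < c] suffices. Conversely, injectivity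
    forces [n <= c ^ 2]. *)
Require Import Defs.
From mathcomp Require Import all_boot all_order all_algebra.
From mathcomp Require Import reals.
From mathcomp Require Import perm lra.
Import Order.TTheory GRing.Theory Num.Theory.

Set Implicit Arguments.
Unset Strict Implicit.
Unset Printing Implicit Defensive.

Lemma leq_card_bigcup (I T : finType) (A : {set I}) (F : I -> {set T}) (m : nat) :
  (forall i, i \in A -> #|F i| <= m) -> #|\bigcup_(i in A) F i| <= #|A| * m.
Proof.
move=> Fm; rewrite -sum_nat_const.
elim/big_rec2: _ => [|i x y iA yx]; first by rewrite cards0.
apply: leq_trans (leq_card_setU _ _) _.
by rewrite leq_add ?Fm.
Qed.

Section Cross.
Variable c : nat.
Local Notation cell := ('I_c * 'I_c)%type.

Definition same_line (a b : cell) : bool := (a.1 == b.1) || (a.2 == b.2).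

Definition cross (a : cell) : {set cell} := [set b | same_line a b].

Lemma same_line_refl a : same_line a a.
Proof. by rewrite /same_line eqxx. Qed.

Lemma same_line_sym a b : same_line a b = same_line b a.
Proof. by rewrite /same_line ![in RHS](eq_sym b.1) ![in RHS](eq_sym b.2). Qed.

Lemma leq_card_cross a : #|cross a| <= c.*2.
Proof.
have -> : cross a = setX [set a.1] setT :|: setX setT [set a.2].
  by apply/setP=> b; rewrite !inE andbT /same_line (eq_sym a.1) (eq_sym a.2).
apply: leq_trans (leq_card_setU _ _) _.
by rewrite !cardsX !cards1 !cardsT card_ord mul1n muln1 addnn.
Qed.

End Cross.

Section Placement.
Variables (G : sgraph) (c : nat).
Local Notation cell := ('I_c * 'I_c)%type.
Implicit Types (p : G -> cell) (S : {set G}).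

(** With the two coordinates of [p] read as colourings, both are proper on the subgraph induced by
    [S]; injectivity of [p] is their orthogonality. *)
Definition good_on p S : Prop :=
  {in S &, forall u v, adj u v -> ~~ same_line (p u) (p v)}.

Definition neighbours (v : G) : {set G} := [set u | adj v u].

Lemma degree_max (v : G) : #|neighbours v| <= max_degree G.
Proof. exact: (leq_bigmax (F := @degree G)). Qed.

(** Only [v] and the occupant [w] of [q], if any, move: [vq] protects [v] in [q], and [wq] protects
    [w] in the old cell of [v]. If [w] is in [S], then [vq] also keeps [v] and [w] non-adjacent, as
    [q] shares a line with itself. *)
Lemma swap_good p S (v : G) (q : cell) :
    injective p -> good_on p S ->
    {in S, forall u, adj v u -> ~~ same_line (p u) q} ->
    {in S, forall w, p w = q ->
       forall u, adj u w -> ~~ same_line (p v) (p u)} ->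
  good_on (tperm (p v) q \o p) (v |: S).
Proof.
move=> p_inj pS vq wq.
(* By symmetry, if exactly one end of an edge moves, it may be taken to be [x]. *)
have swap_half x y : x \in v |: S -> y \in v |: S -> adj x y ->
    (x = v \/ p x = q) \/ (p x != q /\ p y != q /\ x != v /\ y != v) ->
    ~~ same_line (tperm (p v) q (p x)) (tperm (p v) q (p y)).
  move=> xS yS xy; have xNy : x != y.
    by apply: contraTneq xy => ->; rewrite adj_irrefl.
  case=> [xq|[xq [yq [xv yv]]]]; last first.
    rewrite !tpermD 1?eq_sym ?(inj_eq p_inj) //.
    by apply: pS xy; [move: xS|move: yS]; rewrite !inE (negPf xv, negPf yv).
  have [xv|xv] := eqVneq x v.
    move: xNy xy yS; rewrite {}xv tpermL !inE => vy; rewrite eq_sym (negPf vy).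
    move=> xy /= yS; have yNq := vq y yS xy.
    rewrite tpermD ?(inj_eq p_inj) 1?same_line_sym //.
    by apply: contraNneq yNq => ->; apply: same_line_refl.
  case: xq => [/eqP|xq]; first by rewrite (negPf xv).
  move: xS; rewrite xq tpermR !inE (negPf xv) /= => xS.
  have [yv|yv] := eqVneq y v.
    by have := vq x xS; rewrite -yv adj_sym xy xq same_line_refl => /(_ isT).
  rewrite tpermD -?xq ?(inj_eq p_inj) 1?eq_sym //; last by rewrite eq_sym.
  by apply: (wq x xS xq); rewrite adj_sym.
move=> x y xS yS xy /=.
have [xv|xv] := eqVneq x v; first by apply: swap_half => //; left; left.
have [xq|xq] := eqVneq (p x) q; first by apply: swap_half => //; left; right.
have [yv|yv] := eqVneq y v.
  by rewrite same_line_sym; apply: swap_half; rewrite 1?adj_sym //; left; left.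
have [yq|yq] := eqVneq (p y) q.
  by rewrite same_line_sym; apply: swap_half; rewrite 1?adj_sym //; left; right.
by apply: swap_half => //; right.
Qed.

Lemma extend_good p S (v : G) (d : nat) :
    injective p -> good_on p S ->
    #|neighbours v :&: S| <= d -> (d + max_degree G).*2 < c ->
  exists2 p' : G -> cell, injective p' & good_on p' (v |: S).
Proof.
move=> p_inj pS vd dc.
(* In [A], [v] would clash with a neighbour in [S]; the occupants of [B] have a neighbour in the
   cross of [p v]. *)
pose A := \bigcup_(u in neighbours v :&: S) cross (p u).
pose B := p @: \bigcup_(u in p @^-1: cross (p v)) neighbours u.
have cardA : #|A| <= d * c.*2.
  apply: leq_trans (leq_mul vd (leqnn _)).
  by apply: leq_card_bigcup => u _; apply: leq_card_cross.
have cardB : #|B| <= c.*2 * max_degree G.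
  apply: leq_trans (leq_imset_card _ _) _.
  apply: leq_trans (leq_card_bigcup (m := max_degree G) _) _ => [u _|].
    exact: degree_max.
  rewrite leq_mul2r; apply/orP; right.
  apply: leq_trans (leq_card_cross (p v)).
  (* By injectivity a cross holds no more vertices than it has cells. *)
  rewrite -(card_imset _ p_inj); apply: subset_leq_card.
  by apply/subsetP=> a /imsetP[u]; rewrite inE => up ->.
have /set0Pn[q qAB] : ~: (A :|: B) != set0.
  rewrite -card_gt0 -(ltn_add2l #|A :|: B|) addn0 cardsC.
  rewrite card_prod card_ord.
  apply: leq_ltn_trans (leq_card_setU _ _) _.
  apply: leq_ltn_trans (leq_add cardA cardB) _.
  rewrite (mulnC d) -mulnDr -doubleMl doubleMr ltn_mul2l dc andbT.
  exact: leq_ltn_trans dc.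
move: qAB; rewrite !inE negb_or => /andP[qA qB].
exists (tperm (p v) q \o p); first exact: inj_comp perm_inj p_inj.
apply: swap_good => // [u uS vu|w _ wq u uw].
  apply: contra qA => uq; apply/bigcupP; exists u; rewrite !inE //.
  by rewrite vu uS.
apply: contra qB => vu; rewrite -wq; apply: imset_f.
by apply/bigcupP; exists u; rewrite !inE.
Qed.

Lemma degenerate_placement (d : nat) :
    degenerate d G -> #|G| <= c ^ 2 -> (d + max_degree G).*2 < c ->
  exists2 p : G -> cell, injective p & good_on p setT.
Proof.
move=> [s [_ s_all s_deg]] Gc dc.
suff prefix k : exists2 p : G -> cell, injective p &
    good_on p [set u | index u s < k].
  have [p p_inj ps] := prefix (size s); exists p => // u v _ _.
  by apply: ps; rewrite inE index_mem.
elim: k => [|k [p p_inj ps]].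
  (* For the empty prefix any injection into the grid is good. *)
  have Gcell : #|G| <= #|{: cell}| by rewrite card_prod card_ord mulnn.
  exists (fun u => enum_val (widen_ord Gcell (enum_rank u))).
    by move=> u v /enum_val_inj/(congr1 val)/= /val_inj/enum_rank_inj.
  by move=> u v; rewrite inE.
have [v vk|no_v] := pickP (fun v : G => index v s == k).
  have -> : [set u | index u s < k.+1] = v |: [set u | index u s < k].
    apply/setP=> u; rewrite !inE ltnS leq_eqVlt; congr (_ || _).
    apply/eqP/eqP=> [uk|->]; last exact/eqP.
    by rewrite -(nth_index v (s_all u)) uk -(eqP vk) nth_index.
  apply: (extend_good p_inj ps (d := d)) dc => /=.
  apply: leq_trans (s_deg v); apply: subset_leq_card.
  by apply/subsetP=> u; rewrite !inE (eqP vk).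
(* No vertex has index [k], so the prefix does not grow. *)
exists p => // u v; rewrite !inE !ltnS => uk vk.
by apply: ps; rewrite inE ltn_neqAle ?uk ?vk andbT; apply/negbT/no_v.
Qed.

Lemma placement_colourable p :
  injective p -> good_on p setT -> orthogonally_colourable G c.
Proof.
move=> p_inj pT.
apply/existsP; exists [ffun v => (p v).1].
apply/existsP; exists [ffun v => (p v).2].
have p_line u v : adj u v -> ((p u).1 != (p v).1) && ((p u).2 != (p v).2).
  by rewrite -negb_or; apply: pT; rewrite inE.
apply/and3P; split; do 2![apply/forallP=> ?]; apply/implyP; rewrite !ffunE.
- by case/p_line/andP.
- by case/p_line/andP.
rewrite -(inj_eq p_inj) -pair_eqE /pair_eq negb_and.
by do 2!case: eqP.
Qed.

Lemma orthogonally_colourable_card :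
  orthogonally_colourable G c -> #|G| <= c ^ 2.
Proof.
case/existsP=> f /existsP[g /and3P[_ _ /forallP fg]].
have fg_inj : injective (fun v => (f v, g v)).
  move=> u v [fuv guv]; apply/eqP; apply: contraT => uv.
  have /forallP/(_ v)/implyP/(_ uv)/andP[] := fg u.
  by rewrite fuv guv !eqxx.
by have := leq_card _ fg_inj; rewrite card_prod card_ord mulnn.
Qed.

End Placement.

(** The last hypothesis encodes that [c] is the ceiling of the square root of [#|G|] without
    mentioning reals. *)
Lemma orthogonal_chromatic_number_eq (G : sgraph) (d c : nat) :
    degenerate d G -> (d + max_degree G).*2 < c ->
    (forall m, (#|G| <= m ^ 2) = (c <= m)) ->
  orthogonal_chromatic_number G = c.
Proof.
move=> Gd dc cP; rewrite /orthogonal_chromatic_number.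
case: ex_minnP => m /orthogonally_colourable_card; rewrite cP => cm m_min.
have [|p p_inj pT] := degenerate_placement Gd _ dc; first by rewrite cP.
by apply/eqP; rewrite eqn_leq cm m_min ?(placement_colourable p_inj).
Qed.

Local Open Scope ring_scope.
Unset Implicit Arguments.

Theorem theorem5 (R : realType) (G : sgraph) (d n : nat)
    (hn : #|G| = n) (hd : degenerate d G)
    (hDelta : (max_degree G)%:R < (Num.sqrt (n%:R : R) - 2 * d%:R - 1) / 2) :
  (orthogonal_chromatic_number G)%:Z = Num.ceil (Num.sqrt (n%:R : R)).
Proof.
set x := Num.sqrt _ in hDelta *.
have x_ge0 : 0 <= x by apply: sqrtr_ge0.
have ceil_ge0 : 0 <= Num.ceil x by rewrite -(ceil0 R) le_ceil.
have [c cE] : exists c : nat, Num.ceil x = c%:Z.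
  by exists `|Num.ceil x|%N; rewrite gez0_abs.
have cP (m : nat) : (x <= m%:R) = (c <= m)%N.
  by rewrite -[m%:R]/(m%:Z%:~R) -ceil_le_int cE.
rewrite cE; congr Posz; apply: (orthogonal_chromatic_number_eq hd).
  (* Through [cP] the goal becomes [2(d + Delta) < x], while [hDelta] says
     [2(d + Delta) + 1 < x]. *)
  by rewrite ltnNge -cP -ltNge -muln2 natrM natrD; lra.
by move=> m; rewrite hn -cP -ler_sqr ?nnegrE // sqr_sqrtr // -natrX ler_nat.
Qed.
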